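(* Let $I=[0,1]$ and let $f\colon I\to I^2$ be a continuous surjective map of the unit segment onto the unit square $I^2=[0,1]\times[0,1]$. Then there exist points $x,y\in I$ such that $$|f(x)-f(y)|^2>3\tfrac58\,|x-y|,$$ where $3\tfrac58=\tfrac{29}{8}$.
   Context: $|\cdot|$ denotes the Euclidean norm on $\mathbb R^2$ and the absolute value on $\mathbb R$. *)

(* Defs.v *)
From HB Require Import structures.
From mathcomp Require Export all_boot all_order all_algebra.
From mathcomp Require Export all_classical all_reals all_analysis.
Export Order.TTheory GRing.Theory Num.Theory.
Export numFieldNormedType.Exports.
#[export] Set Implicit Arguments.
#[export] Unset Strict Implicit.
#[export] Unset Printing Implicit Defensive.

Local Open Scope ring_scope.

(* The library's norm on [R * R] is the sup norm, so the Euclidean norm has to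
   be introduced separately; it induces the same (product) topology. *)
Definition euclidean_norm (R : realType) (p : R * R) : R :=
  Num.sqrt (p.1 ^+ 2 + p.2 ^+ 2).

(* Main.v *)
Require Import Defs.
From mathcomp Require Import lra.
Local Open Scope classical_set_scope.
Local Open Scope ring_scope.

(** Suppose |f x - f y|^2 <= 29/8 |x - y| throughout.  Then any points visited in
    a given order have consecutive squared distances adding up to at most 29/8.
    For the corners this forces a cyclic order A, B, C, D around the square, as a
    diagonal step would already give 4.  Let A = (0,0) and D = (0,1).  By
    connectedness of the side AD, some X = (0,s) is visited both before B and
    after C, and then necessarily both before A and after D; the chain X A B C D X
    costs 3 + s^2 + (1-s)^2, so 1/4 <= s <= 3/4.  If s is 1/4 or 3/4, this chain
    is tight and (3/8,1/2) cannot be inserted in it.  Otherwise (0,1/2) cannot be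
    visited between A and D and (1/2,1/2) only then, so by connectedness some
    (u,1/2) is visited both inside and outside [tA, tD]; inserting it twice in the
    chain always exceeds 29/8. *)

(** * Connectedness and points visited twice *)

Lemma segment_closed_cover_meet (R : realType) (a b : R) (S1 S2 : set R) :
  a <= b -> closed S1 -> closed S2 -> `[a, b] `<=` S1 `|` S2 ->
  S1 a -> S2 b -> exists x, [/\ x \in `[a, b], S1 x & S2 x].
Proof.
move=> leab cS1 cS2 cover S1a S2b; apply: contrapT => nomeet.
(* Without a common point, [S1] and the complement of [S2] agree on the segment, so [S1] is
   relatively clopen there. *)
have abS1 : `[a, b] `&` S1 = [set` `[a, b]].
  apply: (@segment_connected R a b).
  - by exists a; split => //=; rewrite in_itv /= lexx.
  - exists (~` S2); first exact: closed_openC.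
    apply/seteqP; split => x [xab Sx]; split => //.
      by move=> S2x; apply: nomeet; exists x.
    by case: (cover x xab).
  - by exists S1.
apply: nomeet; exists b; have bab : [set` `[a, b]] b by rewrite /= in_itv /= leab lexx.
by split => //; move: bab; rewrite -{1}abS1 => -[].
Qed.

Section Curve.
Context {R : realType}.
Implicit Types f g : R -> R * R.

Definition fills_square f := forall x y : R, 0 <= x <= 1 -> 0 <= y <= 1 ->
  exists2 t, 0 <= t <= 1 & f t = (x, y).

(** The negation of the theorem, with the times ordered so that the right-hand sides telescope along
    a chain of visits. *)
Definition square_linear_bound f :=
  forall s t : R, 0 <= s -> s <= t -> t <= 1 ->
  ((f s).1 - (f t).1) ^+ 2 + ((f s).2 - (f t).2) ^+ 2 <= 29 / 8 * (t - s).

Definition corners_in_cyclic_order f (tA tB tC tD : R) :=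
  [/\ f tA = (0, 0), f tB = (1, 0), f tC = (1, 1) & f tD = (0, 1)] /\
  [/\ 0 <= tA, tA <= tB, tB <= tC, tC <= tD & tD <= 1].

Lemma square_linear_step f s t a b c d : square_linear_bound f ->
  f s = (a, b) -> f t = (c, d) -> 0 <= s -> s <= t -> t <= 1 ->
  (a - c) ^+ 2 + (b - d) ^+ 2 <= 29 / 8 * (t - s).
Proof. by move=> fH fs ft s0 st t1; have := fH s t s0 st t1; rewrite fs ft. Qed.

Lemma closed_visited f g (F : set R) :
  {within `[0, 1], continuous f} -> continuous g -> closed F ->
  F `<=` `[0, 1] -> closed (g @^-1` (f @` F)).
Proof.
move=> fc gc cF F01; apply: preimage_closed => [x _|]; first exact: gc.
apply: compact_closed; first exact: norm_hausdorff.
apply: continuous_compact; first exact: continuous_subspaceW F01 fc.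
exact: subclosed_compact cF (@segment_compact _ _ _) F01.
Qed.

(** Here [g] will trace a side or a midline of the square. By compactness, the parameters visited
    during [F1] and during [F2] form closed sets; the endpoint conditions make both nonempty. *)
Lemma visited_in_both f g (a b : R) (F1 F2 : set R) :
  {within `[0, 1], continuous f} -> continuous g -> a <= b ->
  closed F1 -> closed F2 -> F1 `<=` `[0, 1] -> F2 `<=` `[0, 1] ->
  (forall x, a <= x <= b -> exists2 t, (F1 `|` F2) t & f t = g x) ->
  (forall t, F2 t -> f t <> g a) -> (forall t, F1 t -> f t <> g b) ->
  exists x t1 t2, [/\ a <= x <= b, F1 t1, F2 t2, f t1 = g x & f t2 = g x].
Proof.
move=> fc gc leab cF1 cF2 F1I F2I cov notF2 notF1.
have [|||||x [xab [t1 F1t1 e1] [t2 F2t2 e2]]] := @segment_closed_cover_meet R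
  a b (g @^-1` (f @` F1)) (g @^-1` (f @` F2)) leab.
- exact: closed_visited.
- exact: closed_visited.
- move=> x; rewrite /= in_itv /= => /cov[t [Ft|Ft] ftx].
    by left; exists t.
  by right; exists t.
- have [|t [Ft|/notF2//] fta] := cov a; first by rewrite lexx.
  by exists t.
- have [|t [/notF1//|Ft] fta] := cov b; first by rewrite lexx leab.
  by exists t.
by exists x, t1, t2; rewrite in_itv /= in xab.
Qed.

(** * Chains of visits with the corners in cyclic order *)

Lemma left_side_double_point f (tA tB tC tD : R) :
  {within `[0, 1], continuous f} -> fills_square f -> square_linear_bound f ->
  corners_in_cyclic_order f tA tB tC tD ->
  exists s t1 t2, [/\ 0 <= s <= 1, 0 <= t1 <= tA, tD <= t2 <= 1,
    f t1 = (0, s) & f t2 = (0, s)].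
Proof.
move=> fc fS fH [[fA fB fC fD] [A0 AB BC CD D1]].
have B0 : 0 <= tB by lra.
have C0 : 0 <= tC by lra.
have D0 : 0 <= tD by lra.
have A1 : tA <= 1 by lra.
have B1 : tB <= 1 by lra.
have C1 : tC <= 1 by lra.
have hAB := square_linear_step fH fA fB A0 AB B1.
have hBC := square_linear_step fH fB fC B0 BC C1.
have hCD := square_linear_step fH fC fD C0 CD D1.
have [|||||||||s [t1 [t2 [/andP[s0 s1] + + f1 f2]]]] :=
  @visited_in_both f (fun s => (0, s)) 0 1 `[0, tB] `[tC, 1] fc.
- by move=> x; apply: (cvg_pair (cvg_cst _) cvg_id).
- by [].
- exact: interval_closed.
- exact: interval_closed.
- move=> t; rewrite /= !in_itv /= => /andP[-> tB']; exact: le_trans B1.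
- move=> t; rewrite /= !in_itv /= => /andP[Ct ->]; rewrite andbT.
  exact: le_trans Ct.
(* A visit strictly between [tB] and [tC] would raise the chain A, B, X, C, D to at least 9/2. *)
- move=> s s01; have [|t /andP[t0 t1] ft] := fS 0 s _ s01.
    by rewrite lexx ler01.
  exists t => //; have [tB'|Bt] := leP t tB; first by left; rewrite /= in_itv /= t0.
  have [Ct|tC'] := leP tC t; first by right; rewrite /= in_itv /= Ct.
  have := square_linear_step fH fB ft B0 (ltW Bt) t1.
  have := square_linear_step fH ft fC t0 (ltW tC') C1.
  have := sqr_ge0 (s - 1 / 2); lra.
(* A after C, or D before B, gives a chain of cost 4 with a diagonal step. *)
- move=> t; rewrite /= in_itv /= => /andP[Ct t1] ft.
  have := square_linear_step fH fC ft C0 Ct t1; lra.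
- move=> t; rewrite /= in_itv /= => /andP[t0 Bt] ft.
  have := square_linear_step fH ft fB t0 Bt B1; lra.
rewrite /= !in_itv /= => /andP[t10 t1B] /andP[Ct2 t21].
have t20 := le_trans C0 Ct2.
have t11 := le_trans t1B B1.
exists s, t1, t2; rewrite s0 s1 t10 t21 f1 f2 !andbT; split=> //.
  (* With X between A and B, the total is at least 11/3 if [t2] follows [tD], and at least 4
     otherwise. *)
  rewrite leNgt; apply/negP => /ltW At1.
  have := square_linear_step fH fA f1 A0 At1 t11.
  have := square_linear_step fH f1 fB t10 t1B B1.
  have [Dt2|/ltW t2D] := leP tD t2.
    have := square_linear_step fH fD f2 D0 Dt2 t21.
    by have := sqr_ge0 (s - 1 / 3); lra.
  have := square_linear_step fH fC f2 C0 Ct2 t21.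
  have := square_linear_step fH f2 fD t20 t2D D1.
  have := sqr_ge0 (s - 1 / 2); lra.
rewrite leNgt; apply/negP => /ltW t2D.
have := square_linear_step fH fC f2 C0 Ct2 t21.
have := square_linear_step fH f2 fD t20 t2D D1.
have := sqr_ge0 (s - 2 / 3).
have [t1A|/ltW At1] := leP t1 tA.
  by have := square_linear_step fH f1 fA t10 t1A A1; lra.
have := square_linear_step fH fA f1 A0 At1 t11.
have := square_linear_step fH f1 fB t10 t1B B1.
have := sqr_ge0 (s - 1 / 2); lra.
Qed.

(** Inserting the point between A and B or between C and D costs exactly the left-hand side; between
    B and C the sum is [5 / 2 + 2 * (1 - u) ^+ 2], no smaller because [u <= 1 / 2]. *)
Lemma inner_midline_cost f (tA tB tC tD u t : R) : square_linear_bound f ->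
  corners_in_cyclic_order f tA tB tC tD ->
  u <= 1 / 2 -> f t = (u, 1 / 2) -> tA <= t <= tD ->
  3 + 2 * (u - 1 / 2) ^+ 2 <= 29 / 8 * (tD - tA).
Proof.
move=> fH [[fA fB fC fD] [A0 AB BC CD D1]] u2 ft /andP[At tD'].
have C1 := le_trans CD D1.
have B1 := le_trans BC C1.
have B0 := le_trans A0 AB.
have C0 := le_trans B0 BC.
have t0 := le_trans A0 At.
have t1 := le_trans tD' D1.
have := square_linear_step fH fA fB A0 AB B1.
have := square_linear_step fH fB fC B0 BC C1.
have := square_linear_step fH fC fD C0 CD D1.
have [tB'|/ltW Bt] := leP t tB.
  have := square_linear_step fH fA ft A0 At t1.
  by have := square_linear_step fH ft fB t0 tB' B1; lra.
have [tC'|/ltW Ct] := leP t tC.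
  have := square_linear_step fH fB ft B0 Bt t1.
  by have := square_linear_step fH ft fC t0 tC' C1; lra.
have := square_linear_step fH fC ft C0 Ct t1.
by have := square_linear_step fH ft fD t0 tD' D1; lra.
Qed.

(* The alternatives correspond to t outside [t1, t2], in [t1, tA], and in [tD, t2]. *)
Lemma outer_midline_cost f (tA tD s t1 t2 u t : R) : square_linear_bound f ->
  f tA = (0, 0) -> f tD = (0, 1) -> f t1 = (0, s) -> f t2 = (0, s) ->
  0 <= t1 <= tA -> tA <= tD -> tD <= t2 <= 1 ->
  f t = (u, 1 / 2) -> (`[0, tA] `|` `[tD, 1]) t ->
  let S := s ^+ 2 + (1 - s) ^+ 2 in
  let T := 29 / 8 * (tA + (1 - tD)) in
  [\/ S + u ^+ 2 + (s - 1 / 2) ^+ 2 <= T,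
      S + 2 * u ^+ 2 + 1 / 2 - s <= T |
      S + 2 * u ^+ 2 + s - 1 / 2 <= T].
Proof.
move=> fH fA fD f1 f2 /andP[t10 t1A] AD /andP[Dt2 t21] ft Ft S T.
rewrite {}/S {}/T; have D1 := le_trans Dt2 t21; have A1 := le_trans AD D1.
have t11 := le_trans t1A A1.
have D0 := le_trans (le_trans t10 t1A) AD; have t20 := le_trans D0 Dt2.
have h1 := square_linear_step fH f1 fA t10 t1A A1.
have h2 := square_linear_step fH fD f2 D0 Dt2 t21.
case: Ft; rewrite /= in_itv /=.
  move=> /andP[t0 tA']; have [tt1|/ltW t1t] := leP t t1.
    by apply: Or31; have := square_linear_step fH ft f1 t0 tt1 t11; lra.
  have := square_linear_step fH f1 ft t10 t1t (le_trans tA' A1).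
  by have := square_linear_step fH ft fA t0 tA' A1; move=> *; apply: Or32; lra.
move=> /andP[Dt t_1]; have [t2t|/ltW tt2] := leP t2 t.
  by apply: Or31; have := square_linear_step fH f2 ft t20 t2t t_1; lra.
have := square_linear_step fH fD ft D0 Dt t_1.
have := square_linear_step fH ft f2 (le_trans D0 Dt) tt2 t21.
by move=> *; apply: Or33; lra.
Qed.

Lemma no_corners_in_cyclic_order f (tA tB tC tD : R) :
  {within `[0, 1], continuous f} -> fills_square f -> square_linear_bound f ->
  ~ corners_in_cyclic_order f tA tB tC tD.
Proof.
move=> fc fS fH fABCD.
have [s [t1 [t2 [s01 t1A Dt2 f1 f2]]]] :=
  left_side_double_point fc fS fH fABCD.
have inner u t := @inner_midline_cost f _ _ _ _ u t fH fABCD.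
move: fABCD => [[fA fB fC fD] [A0 AB BC CD D1]].
have AD := le_trans AB (le_trans BC CD).
have outer u t := @outer_midline_cost f _ _ _ _ _ u t fH fA fD f1 f2 t1A AD Dt2.
(* The right-hand sides of [total] and [excess] add up to 29/8, so [inner] and [outer] can refine
   the two parts of the chain independently. *)
have total : 3 <= 29 / 8 * (tD - tA).
  have := square_linear_step fH fA fB A0 AB (le_trans (le_trans BC CD) D1).
  have := square_linear_step fH fB fC (le_trans A0 AB) BC (le_trans CD D1).
  by have := square_linear_step fH fC fD (le_trans A0 (le_trans AB BC)) CD D1; lra.
have excess : s ^+ 2 + (1 - s) ^+ 2 <= 29 / 8 * (tA + (1 - tD)).
  move: t1A Dt2 => /andP[t10 t1A] /andP[Dt2 t21].
  have := square_linear_step fH f1 fA t10 t1A (le_trans AD D1).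
  by have := square_linear_step fH fD f2 (le_trans A0 AD) Dt2 t21; lra.
have cover u : 0 <= u <= 1 ->
    exists2 t, (`[0, tA] `|` `[tD, 1] `|` `[tA, tD]) t & f t = (u, 1 / 2).
  move=> u01; have [|t /andP[t0 t_1] ft] := fS u (1 / 2) u01; first by lra.
  exists t => //; have [tA'|/ltW At] := leP t tA.
    by left; left; rewrite /= in_itv /= t0.
  have [Dt|/ltW tD'] := leP tD t; first by left; right; rewrite /= in_itv /= Dt.
  by right; rewrite /= in_itv /= At.
have FI : `[0, tA] `|` `[tD, 1] `<=` [set` `[0, 1]].
  move=> t []; rewrite /= !in_itv /= => /andP[a b]; first by rewrite a; lra.
  by rewrite b andbT; lra.
clear fS fH fA fB fC fD f1 f2 t1A Dt2 t1 t2.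
have half0 : 0 <= 1 / 2 :> R by lra.
have [sE|/norP[s14 s34]] := boolP ((s == 1 / 4) || (s == 3 / 4)).
  (* As [3 / 8] is below 1/2, [inner] gives more than 3; as twice its square exceeds 1/4, the
     distance from [s] to 1/2, [outer] gives more than 5/8. *)
  have [|t [Ft|Ft] ft] := cover (3 / 8); first by lra.
    have := outer _ _ ft Ft; clear -total sE.
    by case/orP: sE => /eqP ->; case; lra.
  have uh : 3 / 8 <= 1 / 2 :> R by lra.
  have := inner _ _ uh ft Ft; clear -excess sE.
  by case/orP: sE excess => /eqP ->; lra.
have lt14 : 0 < (s - 1 / 4) ^+ 2 by rewrite exprn_even_gt0 //= subr_eq0.
have lt34 : 0 < (s - 3 / 4) ^+ 2 by rewrite exprn_even_gt0 //= subr_eq0.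
have sh := sqr_ge0 (s - 1 / 2).
(* The midline is followed only up to its middle, the range of [inner]. A visit to its left end
   inside [[tA, tD]] would cost at least 4 in all, and one to its middle outside at least 15/4. *)
have [|||||||||u [t [t' [/andP[u0 u1] Ft Ft' ft ft']]]] :=
  @visited_in_both f (fun u => (u, 1 / 2)) 0 (1 / 2)
    (`[0, tA] `|` `[tD, 1]) `[tA, tD] fc.
- by move=> x; apply: (cvg_pair cvg_id (cvg_cst _)).
- exact: half0.
- by apply: closedU; exact: interval_closed.
- exact: interval_closed.
- exact: FI.
- by move=> t; rewrite /= !in_itv /= => /andP[a b];
    rewrite (le_trans A0 a) (le_trans b D1).
- by move=> u /andP[u0 u1]; apply: cover; rewrite u0; clear -u1; lra.
- by move=> t Ft ft; have := inner _ _ half0 ft Ft; clear -excess sh; lra.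
- move=> t Ft ft; have := outer _ _ ft Ft.
  have s01' : 0 <= s * (1 - s) by case/andP: s01 => *; rewrite mulr_ge0 ?subr_ge0.
  by clear -total sh lt14 lt34; case; lra.
have := inner _ _ u1 ft' Ft'; have := outer _ _ ft Ft.
(* The first alternative totals at least 11/3. The others total [29 / 8 + 4 * (u - 1 / 4) ^+ 2] plus
   [2 * (s - 3 / 4) ^+ 2] or [2 * (s - 1 / 4) ^+ 2], whence the separate treatment of these two
   values of [s]. *)
have := sqr_ge0 (u - 1 / 3); have := sqr_ge0 (u - 1 / 4).
by clear -sh lt14 lt34 => ? ? []; lra.
Qed.

(** * Symmetries of the square and the order of the corners *)

Definition square_linear_filling f :=
  [/\ {within `[0, 1], continuous f}, fills_square f & square_linear_bound f].

Lemma square_linear_filling_comp f (g : R * R -> R * R) : continuous g -> involutive g ->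
  (forall x y, 0 <= x <= 1 -> 0 <= y <= 1 ->
    0 <= (g (x, y)).1 <= 1 /\ 0 <= (g (x, y)).2 <= 1) ->
  (forall p q, ((g p).1 - (g q).1) ^+ 2 + ((g p).2 - (g q).2) ^+ 2 =
    (p.1 - q.1) ^+ 2 + (p.2 - q.2) ^+ 2) ->
  square_linear_filling f -> square_linear_filling (g \o f).
Proof.
move=> gc gK gS gD [fc fS fH]; split.
- by apply: within_continuous_comp => // z _; exact: gc.
- move=> x y x01 y01; have [gx gy] := gS x y x01 y01.
  have [t t01 ft] := fS _ _ gx gy.
  by exists t => //=; rewrite ft -surjective_pairing gK.
- by move=> s t s0 st t1; rewrite /= gD; exact: fH.
Qed.

Lemma square_linear_filling_swap f : square_linear_filling f ->
  square_linear_filling ((fun p => (p.2, p.1)) \o f).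
Proof.
apply: square_linear_filling_comp => [p|[]|x y|p q] //=; last exact: addrC.
have c1 : p.1 @[p --> p] --> p.1 by exact: cvg_fst.
have c2 : p.2 @[p --> p] --> p.2 by exact: cvg_snd.
exact: (cvg_pair c2 c1).
Qed.

Lemma square_linear_filling_flip f : square_linear_filling f ->
  square_linear_filling ((fun p => (1 - p.1, p.2)) \o f).
Proof.
apply: square_linear_filling_comp => [p|[x y]|x y x01 y01|p q] /=.
- have c1 : 1 - p.1 @[p --> p] --> 1 - p.1.
    by apply: cvgB; [exact: cvg_cst|exact: cvg_fst].
  have c2 : p.2 @[p --> p] --> p.2 by exact: cvg_snd.
  exact: (cvg_pair c1 c2).
- by rewrite subKr.
- by split=> //; lra.
- by lra.
Qed.

(** Swapping the coordinates allows [b <= d]. Then the orders A, C, B, D and A, B, D, C cost 5 and 4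
    because of their diagonal steps, which leaves only the cyclic order. *)
Lemma origin_not_first_corner f (a b c d : R) : square_linear_filling f ->
  f a = (0, 0) -> f b = (1, 0) -> f c = (1, 1) -> f d = (0, 1) ->
  0 <= a -> a <= b -> a <= c -> a <= d -> b <= 1 -> c <= 1 -> d <= 1 -> False.
Proof.
wlog bd : f b d / b <= d.
  move=> wl fF fa fb fc fd a0 ab ac ad b1 c1 d1.
  have [bd|/ltW db] := leP b d; first exact: (wl f b d).
  by apply: (wl _ d b db (square_linear_filling_swap fF)) => //=;
    rewrite ?fa ?fb ?fc ?fd.
move=> [fI fS fH] fa fb fc fd a0 ab ac ad b1 c1 d1.
have b0 := le_trans a0 ab; have c0 := le_trans a0 ac.
have hbd := square_linear_step fH fb fd b0 bd d1.
have [cb|/ltW bc] := leP c b.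
  have := square_linear_step fH fa fc a0 ac c1.
  by have := square_linear_step fH fc fb c0 cb b1; lra.
have [cd|/ltW dc] := leP c d.
  by apply: (no_corners_in_cyclic_order fI fS fH (tA := a)); split; split; eassumption.
have := square_linear_step fH fa fb a0 ab b1.
by have := square_linear_step fH fd fc (le_trans a0 ad) dc c1; lra.
Qed.

Lemma no_square_linear_filling f : ~ square_linear_filling f.
Proof.
move=> fF; have [_ fS _] := fF.
have z01 : 0 <= (0 : R) <= 1 by rewrite lexx ler01.
have o01 : 0 <= (1 : R) <= 1 by rewrite lexx ler01.
have [a /andP[a0 a1] fa] := fS 0 0 z01 z01.
have [b /andP[b0 b1] fb] := fS 1 0 o01 z01.
have [c /andP[c0 c1] fc] := fS 1 1 o01 o01.
have [d /andP[d0 d1] fd] := fS 0 1 z01 o01.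
have fF1 := square_linear_filling_flip fF.
(* Conjugating the flip by the swap reflects the second coordinate; the two reflections bring
   whichever corner is visited first to the origin. *)
have flip2 g (gF : square_linear_filling g) := square_linear_filling_swap
  (square_linear_filling_flip (square_linear_filling_swap gF)).
have fF2 := flip2 _ fF; have fF12 := flip2 _ fF1.
have [ab|/ltW ba] := leP a b; have [cd|/ltW dc] := leP c d.
- have [ac|/ltW ca] := leP a c.
    by apply: (origin_not_first_corner fF fa fb fc fd) => //; lra.
  by apply: (@origin_not_first_corner _ c d a b fF12) => //=;
    rewrite ?fa ?fb ?fc ?fd /= ?subrr ?subr0 //; lra.
- have [ad|/ltW da] := leP a d.
    by apply: (origin_not_first_corner fF fa fb fc fd) => //; lra.
  by apply: (@origin_not_first_corner _ d c b a fF2) => //=;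
    rewrite ?fa ?fb ?fc ?fd /= ?subrr ?subr0 //; lra.
- have [bc|/ltW cb] := leP b c.
    by apply: (@origin_not_first_corner _ b a d c fF1) => //=;
      rewrite ?fa ?fb ?fc ?fd /= ?subrr ?subr0 //; lra.
  by apply: (@origin_not_first_corner _ c d a b fF12) => //=;
    rewrite ?fa ?fb ?fc ?fd /= ?subrr ?subr0 //; lra.
- have [bd|/ltW db] := leP b d.
    by apply: (@origin_not_first_corner _ b a d c fF1) => //=;
      rewrite ?fa ?fb ?fc ?fd /= ?subrr ?subr0 //; lra.
  by apply: (@origin_not_first_corner _ d c b a fF2) => //=;
    rewrite ?fa ?fb ?fc ?fd /= ?subrr ?subr0 //; lra.
Qed.

End Curve.

Theorem theorem2 (R : realType) (f : R -> R * R)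
  (f_cont : {within `[0, 1], continuous f})
  (f_onto : f @` `[0, 1] = `[0, 1] `*` `[0, 1]) :
  exists x y : R, [/\ x \in `[0, 1], y \in `[0, 1] &
    euclidean_norm (f x - f y) ^+ 2 > 29 / 8 * `|x - y|].
Proof.
apply: contrapT => nex; apply: (@no_square_linear_filling R f); split=> //.
  move=> x y x01 y01.
  have : (f @` `[0, 1]) (x, y) by rewrite f_onto; split; rewrite /= in_itv.
  by case=> t; rewrite /= in_itv /= => t01 ft; exists t.
move=> s t s0 st t1; rewrite leNgt; apply/negP => lt; apply: nex.
exists s, t; split; rewrite ?in_itv /= ?s0 ?t1 ?(le_trans st) ?(le_trans s0) //.
rewrite /euclidean_norm sqr_sqrtr ?addr_ge0 ?sqr_ge0 //.
by rewrite distrC ger0_norm ?subr_ge0.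
Qed.
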